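(* Let $G$ be a group object with negatives in a Cartesian tangent category $(\mathbb X,\mathbb T)$ whose Lie functor $\mathfrak g(-)$ is tangently representable, with representing object $\mathfrak g$ and universal $\mathfrak g$-PLIVF $\omega:G\times\mathfrak g\to TG$. Put $\iota_{\mathsf e}:=\langle{!}\mathsf e,\mathrm{id}_{\mathfrak g}\rangle\,\omega:\mathfrak g\to TG$. Then the square $$\iota_{\mathsf e}\,p_G={!}\,\mathsf e$$ (with top $\iota_{\mathsf e}:\mathfrak g\to TG$, left $!:\mathfrak g\to *$, right $p_G:TG\to G$, bottom $\mathsf e:*\to G$) is a tangent pullback. (In particular $G$ is a Lie group with tangent space $\mathfrak g$ at the unit.)
   Context: Conventions. Composition is diagrammatic: $fg$ means first $f$, then $g$; $\langle f,g\rangle$ is pairing, $\pi_i$ are projections, $*$ is the terminal object and $!$ denotes maps to $*$. Tangent categories. A tangent structure $\mathbb T=(T,p,z,s,l,c)$ on a category $\mathbb X$ consists of an endofunctor $T$ and natural transformations $p_M:TM\to M$, $z_M:M\to TM$, $s_M:T_2M\to TM$, $l_M:TM\to TTM$, $c_M:TTM\to TTM$, where the $n$-fold pullback $T_nM$ of $p_M$ along itself exists and is preserved by all $T^k$, such that: $(p_M,z_M,s_M)$ is an additive bundle (a commutative monoid in $\mathbb X/M$); $(z_M,l_M):(p_M,z_M,s_M)\to(Tp_M,Tz_M,Ts_M)$ and $(\mathrm{id}_{TM},c_M):(p_{TM},z_{TM},s_{TM})\to(Tp_M,Tz_M,Ts_M)$ are additive bundle morphisms; $l_M\,Tl_M=l_M\,l_{TM}$,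 $c_Mc_M=\mathrm{id}$, $Tc_M\,c_{TM}\,Tc_M=c_{TM}\,Tc_M\,c_{TM}$, $l_Mc_M=l_M$, $l_{TM}\,Tc_M\,c_{TM}=c_M\,Tl_M$; and, with $\xi_M:=(z_{TM}\times l_M)\,Ts_M:T_2M\to TTM$, the square $\xi_M\,Tp_M=\pi_1p_Mz_M$ exhibits $T_2M$ as the pullback of $Tp_M$ along $z_M$. It is Cartesian if $\mathbb X$ has finite products and $T$ preserves them (we identify $T(A\times B)=TA\times TB$). An object $M$ admits negatives if there is $n_M:TM\to TM$ with $n_Mp_M=p_M$ and $\langle\mathrm{id},n_M\rangle s_M=p_Mz_M$. A tangent pullback is a pullback preserved by all $T^n$, $n\ge0$. A group object is a Lie group if the tangent pullback of $p_G$ along its unit exists (the tangent space at the unit). Lie functor. Let $G$ be a group object with unit $\mathsf e:*\to G$ and multiplication $\mathsf m_G$; each $T^nG$ is a group object with unit $T^n\mathsf e$ and multiplication $T^n\mathsf m_G$. An $A$-PLIVF on $G$ is a map $X:G\times A\to TG$ with $Xp_G=\pi_1$ and $(\mathsf m_G\times\mathrm{id}_A)X=(z_G\times X)\,T\mathsf m_G$. $\mathfrak g(A)$ is the set of $A$-PLIVFs, and $\mathfrak g(f)(X)=(\mathrm{id}_G\times f)X$ for $f:A\to B$; the contravariant functor $\mathfrak g(-)$ is the Lie functor of $G$. Let $(T^n\mathfrak g)(-)$ be the Lie functor of $T^nG$, and let $\tau_A^{T^nG}:(T^n\mathfrak g)(A)\to(T^{n+1}\mathfrak g)(TA)$ send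 $X$ to $TX\,c_{T^nG}$. The Lie functor is tangently representable if there is an object $\mathfrak g$ and, for every $n\ge0$, an isomorphism $\varphi_A^{T^nG}:(T^n\mathfrak g)(A)\to\mathbb X(A,T^n\mathfrak g)$ natural in $A$, such that $\varphi_{TA}^{T^{n+1}G}(\tau_A^{T^nG}(X))=T(\varphi_A^{T^nG}(X))$ for all $n,A,X$. The universal PLIVF is $\omega=(\varphi^G_{\mathfrak g})^{-1}(\mathrm{id}_{\mathfrak g})$. *)

(* Defs.v *)
From mathcomp Require Import all_boot.
From Stdlib Require Import ProofIrrelevance.

Set Implicit Arguments.
Unset Strict Implicit.
Unset Printing Implicit Defensive.

Declare Scope cat_scope.
Delimit Scope cat_scope with cat.
Local Open Scope cat_scope.

Reserved Notation "A ~> B" (at level 90, right associativity).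
Reserved Notation "f ;; g" (at level 50, left associativity).

(* Composition [f ;; g] is diagrammatic: first [f], then [g]. *)
Record category := Category {
  obj :> Type;
  hom : obj -> obj -> Type;
  idm : forall A, hom A A;
  comp : forall A B C, hom A B -> hom B C -> hom A C;
  comp1m : forall A B (f : hom A B), comp (idm A) f = f;
  compm1 : forall A B (f : hom A B), comp f (idm B) = f;
  compA : forall A B C D (f : hom A B) (g : hom B C) (h : hom C D),
    comp f (comp g h) = comp (comp f g) h }.

Arguments hom {c} A B.
Arguments idm {c} A.
Arguments comp {c A B C} f g.

Notation "A ~> B" := (hom A B) : cat_scope.
Notation "f ;; g" := (comp f g) : cat_scope.

Record endofunctor (X : category) := Endofunctor {
  fobj :> X -> X;
  fmap : forall A B : X, A ~> B -> fobj A ~> fobj B;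
  fmap1 : forall A : X, fmap (idm A) = idm (fobj A);
  fmapM : forall (A B C : X) (f : A ~> B) (g : B ~> C),
    fmap (f ;; g) = fmap f ;; fmap g }.

Arguments fmap {X} e {A B} f.

Fixpoint iter_obj (X : category) (T : endofunctor X) (n : nat) (A : X) : X :=
  if n is k.+1 then T (iter_obj T k A) else A.

Fixpoint iter_map (X : category) (T : endofunctor X) (n : nat) (A B : X)
    (f : A ~> B) : iter_obj T n A ~> iter_obj T n B :=
  match n with
  | 0 => f
  | k.+1 => fmap T (iter_map T k f)
  end.

(* The square    P --u--> A
                 |        |
                 v        f
                 |        |
                 B --g--> C    is a pullback. *)
Definition is_pullback (X : category) (P A B C : X)
    (u : P ~> A) (v : P ~> B) (f : A ~> C) (g : B ~> C) : Prop :=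
  u ;; f = v ;; g /\
  forall (W : X) (a : W ~> A) (b : W ~> B), a ;; f = b ;; g ->
    exists! w : W ~> P, w ;; u = a /\ w ;; v = b.

Definition is_tangent_pullback (X : category) (T : endofunctor X)
    (P A B C : X) (u : P ~> A) (v : P ~> B) (f : A ~> C) (g : B ~> C) : Prop :=
  forall n : nat, is_pullback (iter_map T n u) (iter_map T n v)
                              (iter_map T n f) (iter_map T n g).

(* The leg [b] to the base makes the case [n = 0] (the base itself) correct. *)
Definition is_fibre_power (X : category) (n : nat) (E M : X) (p : E ~> M)
    (P : X) (b : P ~> M) (pr : 'I_n -> (P ~> E)) : Prop :=
  (forall i, pr i ;; p = b) /\
  forall (W : X) (a : W ~> M) (u : 'I_n -> (W ~> E)),
    (forall i, u i ;; p = a) ->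
    exists! w : W ~> P, w ;; b = a /\ forall i, w ;; pr i = u i.

Record bundle (X : category) := Bundle {
  btot : X;
  bbase : X;
  bproj : btot ~> bbase;
  bzero : bbase ~> btot;
  bsq : X;
  bpr1 : bsq ~> btot;
  bpr2 : bsq ~> btot;
  bsum : bsq ~> btot }.

(* [adds_to u v w] says that [<u, v>] exists and [w = <u, v> ;; bsum E].  When
   [bsq E] is the pullback of [bproj E] along itself, [<u, v>] is unique. *)
Definition adds_to (X : category) (E : bundle X) (W : X)
    (u v w : W ~> btot E) : Prop :=
  exists t : W ~> bsq E, [/\ t ;; bpr1 E = u, t ;; bpr2 E = v
                           & t ;; bsum E = w].

(* Associativity is stated at an arbitrary cone [(u, v, w)] over three copies of
   [bproj E], in particular at the three-fold fibre power of [bproj E]. *)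
Record is_additive_bundle (X : category) (E : bundle X) : Prop := {
  bundle_pb : is_pullback (bpr1 E) (bpr2 E) (bproj E) (bproj E);
  bundle_zero_proj : bzero E ;; bproj E = idm (bbase E);
  bundle_sum_proj : bsum E ;; bproj E = bpr1 E ;; bproj E;
  bundle_addA : forall (W : X) (u v w uv vw uv_w u_vw : W ~> btot E),
    adds_to u v uv -> adds_to uv w uv_w ->
    adds_to v w vw -> adds_to u vw u_vw -> uv_w = u_vw;
  bundle_addC : adds_to (bpr2 E) (bpr1 E) (bsum E);
  bundle_add0 :
    adds_to (idm (btot E)) (bproj E ;; bzero E) (idm (btot E)) }.

(* [f] is the map of base objects and [g] the map of total objects. *)
Record is_additive_bundle_morphism (X : category) (E F : bundle X)
    (f : bbase E ~> bbase F) (g : btot E ~> btot F) : Prop := {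
  bundle_mor_proj : g ;; bproj F = bproj E ;; f;
  bundle_mor_zero : bzero E ;; g = f ;; bzero F;
  bundle_mor_sum : adds_to (bpr1 E ;; g) (bpr2 E ;; g) (bsum E ;; g) }.

Definition map_bundle (X : category) (T : endofunctor X) (E : bundle X) :
    bundle X :=
  Bundle (fmap T (bproj E)) (fmap T (bzero E))
         (fmap T (bpr1 E)) (fmap T (bpr2 E)) (fmap T (bsum E)).

Record tangent_data (X : category) := TangentData {
  tanT :> endofunctor X;
  tan_p : forall M : X, tanT M ~> M;
  tan_z : forall M : X, M ~> tanT M;
  tan_T2 : X -> X;
  tan_pr1 : forall M : X, tan_T2 M ~> tanT M;
  tan_pr2 : forall M : X, tan_T2 M ~> tanT M;
  tan_s : forall M : X, tan_T2 M ~> tanT M;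
  tan_l : forall M : X, tanT M ~> tanT (tanT M);
  tan_c : forall M : X, tanT (tanT M) ~> tanT (tanT M) }.

Definition tan_bundle (X : category) (T : tangent_data X) (M : X) : bundle X :=
  Bundle (tan_p T M) (tan_z T M) (tan_pr1 T M) (tan_pr2 T M) (tan_s T M).

Record is_tangent (X : category) (T : tangent_data X) : Prop := {
  tan_pN : forall (M N : X) (f : M ~> N),
    fmap T f ;; tan_p T N = tan_p T M ;; f;
  tan_zN : forall (M N : X) (f : M ~> N),
    f ;; tan_z T N = tan_z T M ;; fmap T f;
  tan_sN : forall (M N : X) (f : M ~> N),
    adds_to (E := tan_bundle T N)
      (tan_pr1 T M ;; fmap T f) (tan_pr2 T M ;; fmap T f)
      (tan_s T M ;; fmap T f);
  tan_lN : forall (M N : X) (f : M ~> N),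
    fmap T f ;; tan_l T N = tan_l T M ;; fmap T (fmap T f);
  tan_cN : forall (M N : X) (f : M ~> N),
    fmap T (fmap T f) ;; tan_c T N = tan_c T M ;; fmap T (fmap T f);
  tan_T2_pb : forall M : X, is_tangent_pullback T
    (tan_pr1 T M) (tan_pr2 T M) (tan_p T M) (tan_p T M);
  tan_Tn : forall (n : nat) (M : X),
    exists (P : X) (b : P ~> M) (pr : 'I_n -> (P ~> T M)),
      forall k : nat, is_fibre_power (iter_map T k (tan_p T M))
        (iter_map T k b) (fun i => iter_map T k (pr i));
  tan_additive : forall M : X, is_additive_bundle (tan_bundle T M);
  tan_l_additive : forall M : X,
    is_additive_bundle_morphism (E := tan_bundle T M)
      (F := map_bundle T (tan_bundle T M)) (tan_z T M) (tan_l T M);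
  tan_c_additive : forall M : X,
    is_additive_bundle_morphism (E := tan_bundle T (T M))
      (F := map_bundle T (tan_bundle T M)) (idm (T M)) (tan_c T M);
  tan_ll : forall M : X,
    tan_l T M ;; fmap T (tan_l T M) = tan_l T M ;; tan_l T (T M);
  tan_cc : forall M : X, tan_c T M ;; tan_c T M = idm (T (T M));
  tan_ccc : forall M : X,
    fmap T (tan_c T M) ;; tan_c T (T M) ;; fmap T (tan_c T M) =
    tan_c T (T M) ;; fmap T (tan_c T M) ;; tan_c T (T M);
  tan_lc : forall M : X, tan_l T M ;; tan_c T M = tan_l T M;
  tan_lcc : forall M : X,
    tan_l T (T M) ;; fmap T (tan_c T M) ;; tan_c T (T M) =
    tan_c T M ;; fmap T (tan_l T M);
  (* [xi = (z_TM x l_M) ;; T s_M] *)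
  tan_universal : forall M : X, exists xi : tan_T2 T M ~> T (T M),
    adds_to (E := map_bundle T (tan_bundle T M))
      (tan_pr1 T M ;; tan_z T (T M)) (tan_pr2 T M ;; tan_l T M) xi /\
    is_pullback xi (tan_pr1 T M ;; tan_p T M) (fmap T (tan_p T M)) (tan_z T M) }.

Record tangent_structure (X : category) := TangentStructure {
  tan_data :> tangent_data X;
  tan_axioms : is_tangent tan_data }.

Definition admits_negatives (X : category) (T : tangent_structure X) (M : X) :
    Prop :=
  exists n : T M ~> T M,
    n ;; tan_p T M = tan_p T M /\
    adds_to (E := tan_bundle T M) (idm (T M)) n (tan_p T M ;; tan_z T M).

Record finite_products (X : category) := FiniteProducts {
  one : X;
  bang : forall A : X, A ~> one;
  bangE : forall (A : X) (f : A ~> one), f = bang A;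
  prd : X -> X -> X;
  pi1 : forall A B : X, prd A B ~> A;
  pi2 : forall A B : X, prd A B ~> B;
  pair : forall W A B : X, W ~> A -> W ~> B -> W ~> prd A B;
  pair_pi1 : forall (W A B : X) (f : W ~> A) (g : W ~> B),
    pair f g ;; pi1 A B = f;
  pair_pi2 : forall (W A B : X) (f : W ~> A) (g : W ~> B),
    pair f g ;; pi2 A B = g;
  pairE : forall (W A B : X) (h : W ~> prd A B),
    h = pair (h ;; pi1 A B) (h ;; pi2 A B) }.

Arguments one {X} P : rename.
Arguments bang {X} P A : rename.
Arguments prd {X} P A B : rename.
Arguments pi1 {X} P A B : rename.
Arguments pi2 {X} P A B : rename.
Arguments pair {X} P {W A B} _ _ : rename.

Definition prd_map (X : category) (P : finite_products X) (A B C D : X)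
    (f : A ~> B) (g : C ~> D) : prd P A C ~> prd P B D :=
  pair P (pi1 P A C ;; f) (pi2 P A C ;; g).

Definition prd_assoc (X : category) (P : finite_products X) (A B C : X) :
    prd P (prd P A B) C ~> prd P A (prd P B C) :=
  pair P (pi1 P (prd P A B) C ;; pi1 P A B)
         (pair P (pi1 P (prd P A B) C ;; pi2 P A B) (pi2 P (prd P A B) C)).

(* [T] preserves finite products: the canonical maps [T 1 -> 1] and
   [T (A x B) -> T A x T B] have two-sided inverses ([1 -> T 1 -> 1] is the
   identity because [1] is terminal).  The identification
   [T (A x B) = T A x T B] is made explicit through these inverses. *)
Record cartesian_tangent (X : category) (P : finite_products X)
    (T : tangent_structure X) := CartesianTangent {
  tan_one : one P ~> T (one P);
  tan_prd : forall A B : X, prd P (T A) (T B) ~> T (prd P A B);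
  bang_tan_one : bang P (T (one P)) ;; tan_one = idm (T (one P));
  tan_prdK : forall A B : X,
    tan_prd A B ;; pair P (fmap T (pi1 P A B)) (fmap T (pi2 P A B)) =
    idm (prd P (T A) (T B));
  tan_prdVK : forall A B : X,
    pair P (fmap T (pi1 P A B)) (fmap T (pi2 P A B)) ;; tan_prd A B =
    idm (T (prd P A B)) }.

Record group_object (X : category) (P : finite_products X) (G : X) :=
    GroupObject {
  gunit : one P ~> G;
  gmul : prd P G G ~> G;
  ginv : G ~> G;
  gmulA : prd_map P gmul (idm G) ;; gmul =
    prd_assoc P G G G ;; prd_map P (idm G) gmul ;; gmul;
  gmul1l : pair P (bang P G ;; gunit) (idm G) ;; gmul = idm G;
  gmul1r : pair P (idm G) (bang P G ;; gunit) ;; gmul = idm G;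
  gmulVl : pair P ginv (idm G) ;; gmul = bang P G ;; gunit;
  gmulVr : pair P (idm G) ginv ;; gmul = bang P G ;; gunit }.

Section ProductFacts.
Variables (X : category) (P : finite_products X).

Lemma prd_ext (W A B : X) (f g : W ~> prd P A B) :
  f ;; pi1 P A B = g ;; pi1 P A B -> f ;; pi2 P A B = g ;; pi2 P A B -> f = g.
Proof. by move=> e1 e2; rewrite (pairE f) (pairE g) e1 e2. Qed.

Lemma comp_pair (V W A B : X) (h : V ~> W) (f : W ~> A) (g : W ~> B) :
  h ;; pair P f g = pair P (h ;; f) (h ;; g).
Proof. by apply: prd_ext; rewrite -!compA ?pair_pi1 ?pair_pi2. Qed.

Lemma pair_prd_map (W A B C D : X) (a : W ~> A) (c : W ~> C)
    (f : A ~> B) (g : C ~> D) :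
  pair P a c ;; prd_map P f g = pair P (a ;; f) (c ;; g).
Proof. by rewrite comp_pair !compA pair_pi1 pair_pi2. Qed.

Lemma bang_comp (A B : X) (f : A ~> B) : f ;; bang P B = bang P A.
Proof. exact: bangE. Qed.

Lemma prd_map_pi1 (A B A' B' : X) (f : A ~> A') (h : B ~> B') :
  prd_map P f h ;; pi1 P A' B' = pi1 P A B ;; f.
Proof. exact: pair_pi1. Qed.

Lemma prd_map_pi2 (A B A' B' : X) (f : A ~> A') (h : B ~> B') :
  prd_map P f h ;; pi2 P A' B' = pi2 P A B ;; h.
Proof. exact: pair_pi2. Qed.

Lemma prd_assoc_pi1 (A B D : X) :
  prd_assoc P A B D ;; pi1 P A (prd P B D) =
  pi1 P (prd P A B) D ;; pi1 P A B.
Proof. exact: pair_pi1. Qed.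

Lemma prd_assoc_pi21 (A B D : X) :
  prd_assoc P A B D ;; pi2 P A (prd P B D) ;; pi1 P B D =
  pi1 P (prd P A B) D ;; pi2 P A B.
Proof. by rewrite /prd_assoc !pair_pi2 pair_pi1. Qed.

Lemma prd_assoc_pi22 (A B D : X) :
  prd_assoc P A B D ;; pi2 P A (prd P B D) ;; pi2 P B D =
  pi2 P (prd P A B) D.
Proof. by rewrite /prd_assoc !pair_pi2. Qed.

Lemma prd_mapM (A B D A' B' D' : X) (f : A ~> B) (h : B ~> D)
    (f' : A' ~> B') (h' : B' ~> D') :
  prd_map P f f' ;; prd_map P h h' = prd_map P (f ;; h) (f' ;; h').
Proof. by rewrite {1}/prd_map pair_prd_map /prd_map !compA. Qed.

Lemma prd_assocN (A B D A' B' D' : X) (f : A ~> A') (h : B ~> B')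
    (k : D ~> D') :
  prd_map P (prd_map P f h) k ;; prd_assoc P A' B' D' =
  prd_assoc P A B D ;; prd_map P f (prd_map P h k).
Proof.
rewrite /prd_assoc !pair_prd_map !comp_pair !compA /prd_map.
by rewrite !pair_pi1 pair_pi2 -!compA pair_pi1 pair_pi2.
Qed.

Lemma prd_map1 (A B : X) : prd_map P (idm A) (idm B) = idm (prd P A B).
Proof. by rewrite /prd_map !compm1 [RHS]pairE !comp1m. Qed.

End ProductFacts.

Section TangentGroup.
Variables (X : category) (P : finite_products X) (T : tangent_structure X).
Variable C : cartesian_tangent P T.

Lemma tan_prd_pi1 (A B : X) : tan_prd C A B ;; fmap T (pi1 P A B) = pi1 P _ _.
Proof.
have e := tan_prdK C A B; rewrite comp_pair in e.
by rewrite -[RHS]comp1m -e pair_pi1.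
Qed.

Lemma tan_prd_pi2 (A B : X) : tan_prd C A B ;; fmap T (pi2 P A B) = pi2 P _ _.
Proof.
have e := tan_prdK C A B; rewrite comp_pair in e.
by rewrite -[RHS]comp1m -e pair_pi2.
Qed.

Lemma tan_ext (W A B : X) (f g : W ~> T (prd P A B)) :
  f ;; fmap T (pi1 P A B) = g ;; fmap T (pi1 P A B) ->
  f ;; fmap T (pi2 P A B) = g ;; fmap T (pi2 P A B) -> f = g.
Proof.
move=> e1 e2; rewrite -[f]compm1 -[g]compm1 -(tan_prdVK C) !compA !comp_pair.
by rewrite e1 e2.
Qed.

Lemma pair_tan_prd (W A B : X) (f : W ~> A) (g : W ~> B) :
  pair P (fmap T f) (fmap T g) ;; tan_prd C A B = fmap T (pair P f g).
Proof.
by apply: tan_ext; rewrite -compA ?tan_prd_pi1 ?tan_prd_pi2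
  ?pair_pi1 ?pair_pi2 -fmapM ?pair_pi1 ?pair_pi2.
Qed.

Lemma tan_prd_map (A A' B B' : X) (f : A ~> A') (g : B ~> B') :
  prd_map P (fmap T f) (fmap T g) ;; tan_prd C A' B' =
  tan_prd C A B ;; fmap T (prd_map P f g).
Proof.
apply: tan_ext.
  by rewrite -!compA tan_prd_pi1 -fmapM /prd_map !pair_pi1 fmapM compA
    tan_prd_pi1.
by rewrite -!compA tan_prd_pi2 -fmapM /prd_map !pair_pi2 fmapM compA
  tan_prd_pi2.
Qed.

Lemma bang_tan (A : X) : bang P (T A) ;; tan_one C = fmap T (bang P A).
Proof.
rewrite -(bang_comp P (fmap T (bang P A))) -compA bang_tan_one.
by rewrite compm1.
Qed.

Definition tan_unit (G : X) (e : one P ~> G) : one P ~> T G :=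
  tan_one C ;; fmap T e.

Definition tan_mul (G : X) (m : prd P G G ~> G) : prd P (T G) (T G) ~> T G :=
  tan_prd C G G ;; fmap T m.

Lemma pair_tan_mul (W G : X) (m : prd P G G ~> G) (f g : W ~> G) :
  pair P (fmap T f) (fmap T g) ;; tan_mul m = fmap T (pair P f g ;; m).
Proof. by rewrite /tan_mul compA pair_tan_prd fmapM. Qed.

Lemma bang_tan_unit (A G : X) (e : one P ~> G) :
  bang P (T A) ;; tan_unit e = fmap T (bang P A ;; e).
Proof. by rewrite /tan_unit compA bang_tan fmapM. Qed.

Lemma tan_assoc (A B D : X) :
  prd_map P (tan_prd C A B) (idm (T D)) ;; tan_prd C (prd P A B) D ;;
    fmap T (prd_assoc P A B D) =
  prd_assoc P (T A) (T B) (T D) ;; prd_map P (idm (T A)) (tan_prd C B D) ;;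
    tan_prd C A (prd P B D).
Proof.
have fst_ : prd_map P (tan_prd C A B) (idm (T D)) ;; tan_prd C (prd P A B) D
    ;; fmap T (pi1 P (prd P A B) D) = pi1 P _ _ ;; tan_prd C A B.
  by rewrite -compA tan_prd_pi1 prd_map_pi1.
have snd_ : prd_map P (tan_prd C A B) (idm (T D)) ;; tan_prd C (prd P A B) D
    ;; fmap T (pi2 P (prd P A B) D) = pi2 P _ _.
  by rewrite -compA tan_prd_pi2 prd_map_pi2 compm1.
apply: tan_ext.
  rewrite -[LHS]compA -fmapM prd_assoc_pi1 fmapM compA fst_ -compA tan_prd_pi1.
  by rewrite -!compA tan_prd_pi1 prd_map_pi1 compm1 prd_assoc_pi1.
rewrite -[RHS]compA tan_prd_pi2 -[RHS]compA prd_map_pi2 [RHS]compA.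
rewrite -[LHS]compA -fmapM; apply: tan_ext.
  rewrite -[LHS]compA -fmapM prd_assoc_pi21 fmapM compA fst_ -compA tan_prd_pi2.
  by rewrite -[RHS]compA tan_prd_pi1 prd_assoc_pi21.
rewrite -[LHS]compA -fmapM prd_assoc_pi22 snd_.
by rewrite -[RHS]compA tan_prd_pi2 prd_assoc_pi22.
Qed.

Lemma tan_mulA (G : X) (m : prd P G G ~> G) :
  prd_map P m (idm G) ;; m =
    prd_assoc P G G G ;; prd_map P (idm G) m ;; m ->
  prd_map P (tan_mul m) (idm (T G)) ;; tan_mul m =
    prd_assoc P (T G) (T G) (T G) ;; prd_map P (idm (T G)) (tan_mul m) ;;
    tan_mul m.
Proof.
move=> mA.
have -> : prd_map P (tan_mul m) (idm (T G)) =
    prd_map P (tan_prd C G G) (idm _) ;; prd_map P (fmap T m) (fmap T (idm G)).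
  by rewrite {2}/prd_map pair_prd_map fmap1 /prd_map /tan_mul !compA !compm1.
have -> : prd_map P (idm (T G)) (tan_mul m) =
    prd_map P (idm _) (tan_prd C G G) ;; prd_map P (fmap T (idm G)) (fmap T m).
  by rewrite {2}/prd_map pair_prd_map fmap1 /prd_map /tan_mul !compA !compm1.
rewrite /tan_mul -!compA.
rewrite !(compA (prd_map P (fmap T _) _)) !tan_prd_map -!compA -!fmapM mA.
by rewrite -compA fmapM !compA tan_assoc.
Qed.

Definition tan_group (G : X) (g : group_object P G) : group_object P (T G).
Proof.
refine (@GroupObject X P (T G) (tan_unit (gunit g)) (tan_mul (gmul g))
  (fmap T (ginv g)) _ _ _ _ _).
- exact: tan_mulA (gmulA g).
- by rewrite bang_tan_unit -(fmap1 T) pair_tan_mul gmul1l.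
- by rewrite bang_tan_unit -(fmap1 T) pair_tan_mul gmul1r.
- by rewrite bang_tan_unit -(fmap1 T) pair_tan_mul gmulVl.
- by rewrite bang_tan_unit -(fmap1 T) pair_tan_mul gmulVr.
Defined.

Fixpoint iter_group (G : X) (g : group_object P G) (n : nat) :
    group_object P (iter_obj T n G) :=
  match n with
  | 0 => g
  | k.+1 => tan_group (iter_group g k)
  end.

(* The tangent pullback of [p_G] along the unit: [iota : V ~> T G] exhibits [V]
   as the tangent space of [G] at the unit. *)
Definition is_tangent_space (G : X) (g : group_object P G)
    (V : X) (iota : V ~> T G) : Prop :=
  is_tangent_pullback T iota (bang P V) (tan_p T G) (gunit g).

Definition is_lie_group (G : X) (g : group_object P G) : Prop :=
  exists (V : X) (iota : V ~> T G), is_tangent_space g iota.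

Record plivf (G : X) (g : group_object P G) (A : X) := Plivf {
  plivf_map :> prd P G A ~> T G;
  plivf_proj : plivf_map ;; tan_p T G = pi1 P G A;
  plivf_inv : prd_map P (gmul g) (idm A) ;; plivf_map =
    prd_assoc P G G A ;; prd_map P (tan_z T G) plivf_map ;; tan_mul (gmul g) }.

Lemma plivf_ext (G : X) (g : group_object P G) (A : X) (U V : plivf g A) :
  plivf_map U = plivf_map V -> U = V.
Proof.
case: U V => [u pu iu] [v pv iv] /= e; case: v / e in pv iv *.
by rewrite (proof_irrelevance _ pu pv) (proof_irrelevance _ iu iv).
Qed.

(* The functorial action [(id x f) ;; Y] of the Lie functor. *)
Definition plivf_pull (G : X) (g : group_object P G) (A B : X) (f : A ~> B)
    (Y : plivf g B) : plivf g A.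
Proof.
refine (@Plivf G g A (prd_map P (idm G) f ;; Y) _ _).
- by rewrite -compA plivf_proj pair_pi1 compm1.
- rewrite compA prd_mapM compm1 comp1m.
  have -> : prd_map P (gmul g) f =
     prd_map P (prd_map P (idm G) (idm G)) f ;; prd_map P (gmul g) (idm B).
    by rewrite prd_map1 prd_mapM comp1m compm1.
  rewrite -compA plivf_inv 2!compA prd_assocN -!compA.
  by rewrite (compA (prd_map P (idm G) _)) prd_mapM comp1m.
Defined.

Lemma tan_ext2 (W A B : X) (f g : W ~> T (T (prd P A B))) :
  f ;; fmap T (fmap T (pi1 P A B)) = g ;; fmap T (fmap T (pi1 P A B)) ->
  f ;; fmap T (fmap T (pi2 P A B)) = g ;; fmap T (fmap T (pi2 P A B)) -> f = g.
Proof.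
move=> e1 e2; rewrite -[f]compm1 -[g]compm1 -(fmap1 T (T _)) -(tan_prdVK C).
rewrite fmapM !compA; congr (_ ;; _).
by apply: tan_ext; rewrite -!compA -!fmapM ?pair_pi1 ?pair_pi2.
Qed.

Lemma tan_prd_c (A B : X) :
  tan_prd C (T A) (T B) ;; fmap T (tan_prd C A B) ;; tan_c T (prd P A B) =
  prd_map P (tan_c T A) (tan_c T B) ;; tan_prd C (T A) (T B) ;;
    fmap T (tan_prd C A B).
Proof.
have TX := tan_axioms T.
have pp1 : tan_prd C (T A) (T B) ;; fmap T (tan_prd C A B) ;;
    fmap T (fmap T (pi1 P A B)) = pi1 P _ _.
  by rewrite -compA -fmapM tan_prd_pi1 tan_prd_pi1.
have pp2 : tan_prd C (T A) (T B) ;; fmap T (tan_prd C A B) ;;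
    fmap T (fmap T (pi2 P A B)) = pi2 P _ _.
  by rewrite -compA -fmapM tan_prd_pi2 tan_prd_pi2.
rewrite -[RHS]compA; apply: tan_ext2; rewrite -[LHS]compA -(tan_cN TX).
  by rewrite [LHS]compA pp1 -[RHS]compA pp1 prd_map_pi1.
by rewrite [LHS]compA pp2 -[RHS]compA pp2 prd_map_pi2.
Qed.

Lemma tan_c_p (M : X) : tan_c T M ;; tan_p T (T M) = fmap T (tan_p T M).
Proof.
have TX := tan_axioms T.
have /= e := bundle_mor_proj (tan_c_additive TX M).
by rewrite -[tan_p T (T M)]compm1 -e compA (tan_cc TX) comp1m.
Qed.

Lemma tan_z_c (M : X) : fmap T (tan_z T M) ;; tan_c T M = tan_z T (T M).
Proof.
have TX := tan_axioms T.
have /= e := bundle_mor_zero (tan_c_additive TX M).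
by rewrite -[fmap T _]comp1m -e -compA (tan_cc TX) compm1.
Qed.

(* [tau] sends [Y] to [T Y ;; c], where [T Y] is precomposed with the
   identification of [T G x T A] with [T (G x A)]. *)
Definition plivf_tau (G : X) (g : group_object P G) (A : X) (Y : plivf g A) :
    plivf (tan_group g) (T A).
Proof.
refine (@Plivf (T G) (tan_group g) (T A)
  (tan_prd C G A ;; fmap T Y ;; tan_c T G) _ _).
- by rewrite -!compA tan_c_p -fmapM plivf_proj tan_prd_pi1.
- have TX := tan_axioms T; rewrite /=.
  have -> : prd_map P (tan_mul (gmul g)) (idm (T A)) =
      prd_map P (tan_prd C G G) (idm _) ;;
      prd_map P (fmap T (gmul g)) (fmap T (idm A)).
    by rewrite prd_mapM fmap1 compm1.
  rewrite -!compA (compA (prd_map P (fmap T _) _)) tan_prd_map.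
  rewrite -!compA (compA (fmap T _)) -fmapM plivf_inv !fmapM.
  rewrite !compA tan_assoc -!compA; congr (_ ;; _).
  rewrite (compA (tan_prd C G _)) -tan_prd_map /tan_mul fmapM -!compA.
  rewrite (tan_cN TX) (compA (fmap T (tan_prd C G G))).
  rewrite (compA (tan_prd C _ _)) (compA (tan_prd C _ _)) tan_prd_c.
  by rewrite -(tan_z_c G) !compA !prd_mapM comp1m.
Defined.

Record tangent_representation (G : X) (g : group_object P G) :=
    TangentRepresentation {
  rep_obj : X;
  rep_phi : forall (n : nat) (A : X),
    plivf (iter_group g n) A -> (A ~> iter_obj T n rep_obj);
  rep_phiV : forall (n : nat) (A : X),
    (A ~> iter_obj T n rep_obj) -> plivf (iter_group g n) A;
  rep_phiK : forall (n : nat) (A : X),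
    cancel (@rep_phi n A) (@rep_phiV n A);
  rep_phiVK : forall (n : nat) (A : X),
    cancel (@rep_phiV n A) (@rep_phi n A);
  rep_phiN : forall (n : nat) (A B : X) (f : A ~> B)
      (Y : plivf (iter_group g n) B),
    rep_phi (plivf_pull f Y) = f ;; rep_phi Y;
  rep_phi_tau : forall (n : nat) (A : X) (Y : plivf (iter_group g n) A),
    @rep_phi n.+1 (T A) (plivf_tau Y) = fmap T (rep_phi Y) }.

Section Universal.
Variables (G : X) (g : group_object P G) (R : tangent_representation g).

Definition universal_plivf : plivf g (rep_obj R) :=
  rep_phiV (t := R) (n := 0) (idm (rep_obj R)).

Definition iota_unit : rep_obj R ~> T G :=
  pair P (bang P (rep_obj R) ;; gunit g) (idm (rep_obj R)) ;; universal_plivf.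

End Universal.
End TangentGroup.

(* Main.v *)
From mathcomp Require Import all_boot.
Require Import Defs.
Local Open Scope cat_scope.

Set Implicit Arguments.
Unset Strict Implicit.
Unset Printing Implicit Defensive.

(** A left-invariant vector field is determined by its value at the unit, by
    [X(x) = z(x) X(e)], and every family [a] of tangent vectors at the unit
    extends to the left-invariant family [x |-> z(x) a].  Hence evaluation at
    the unit of a universal PLIVF always gives a pullback of [p] along the unit.
    This applies to every [T^n G]: compatibility with [tau] makes the universal
    PLIVF of [T^(n+1) G] the image under [tau] of that of [T^n G], so its value
    at the unit is [T^n iota_e] followed by an iterated canonical flip, and this
    flip turns [p_(T^n G)] into [T^n p_G]. *)

Section GroupElements.
Variables (X : category) (P : finite_products X) (G : X).
Variable g : group_object P G.

Lemma pair_mulA (W : X) (x y z : W ~> G) :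
  pair P (pair P x y ;; gmul g) z ;; gmul g =
  pair P x (pair P y z ;; gmul g) ;; gmul g.
Proof.
have /(congr1 (fun f => pair P (pair P x y) z ;; f)) := gmulA g.
by rewrite !compA pair_prd_map compm1 /prd_assoc !comp_pair !compA
  !(pair_pi1, pair_pi2) compm1.
Qed.

Lemma pair_mul1l (W : X) (x : W ~> G) :
  pair P (bang P W ;; gunit g) x ;; gmul g = x.
Proof.
by rewrite -{2}[x]compm1 -(gmul1l g) compA comp_pair compA bang_comp compm1.
Qed.

Lemma pair_mul1r (W : X) (x : W ~> G) :
  pair P x (bang P W ;; gunit g) ;; gmul g = x.
Proof.
by rewrite -{2}[x]compm1 -(gmul1r g) compA comp_pair compA bang_comp compm1.
Qed.

End GroupElements.

Section TangentSpace.
Variables (X : category) (P : finite_products X) (T : tangent_structure X).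
Variable C : cartesian_tangent P T.

(** [T] preserves the empty product, so [T 1] is again terminal. *)
Lemma tan_one_uniq (W : X) (f : W ~> T (one P)) : f = bang P W ;; tan_one C.
Proof. by rewrite -[f]compm1 -(bang_tan_one C) compA bang_comp. Qed.

Section PlivfAtUnit.
Variables (G : X) (g : group_object P G).

Lemma gunit_z : gunit g ;; tan_z T G = tan_unit C (gunit g).
Proof.
rewrite (tan_zN (tan_axioms T)) (tan_one_uniq (tan_z T _)).
by rewrite -(bangE (idm _)) comp1m.
Qed.

(** With [gunit_z]: naturality of [z] makes it a group homomorphism from [G] to [T G]. *)
Lemma tan_mul_z (W : X) (x y : W ~> G) :
  pair P (x ;; tan_z T G) (y ;; tan_z T G) ;; tan_mul C (gmul g) =
  pair P x y ;; gmul g ;; tan_z T G.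
Proof.
rewrite /tan_mul -[RHS]compA (tan_zN (tan_axioms T) (gmul g)) !compA.
congr (_ ;; _).
by apply: (tan_ext C); rewrite -!compA ?tan_prd_pi1 ?tan_prd_pi2
  ?pair_pi1 ?pair_pi2 -(tan_zN (tan_axioms T)) compA ?pair_pi1
    ?pair_pi2.
Qed.

Lemma tan_mul_p (W : X) (u v : W ~> T G) :
  pair P u v ;; tan_mul C (gmul g) ;; tan_p T G =
  pair P (u ;; tan_p T G) (v ;; tan_p T G) ;; gmul g.
Proof.
rewrite /tan_mul -!compA (tan_pN (tan_axioms T)) !compA; congr (_ ;; _).
apply: prd_ext; rewrite -!compA -(tan_pN (tan_axioms T)) ?pair_pi1 ?pair_pi2.
  by rewrite (compA (tan_prd _ _ _)) tan_prd_pi1 compA pair_pi1.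
by rewrite (compA (tan_prd _ _ _)) tan_prd_pi2 compA pair_pi2.
Qed.

Definition plivf_unit (A : X) (Y : plivf C g A) : A ~> T G :=
  pair P (bang P A ;; gunit g) (idm A) ;; Y.

Lemma plivf_unit_pull (A B : X) (f : A ~> B) (Y : plivf C g B) :
  plivf_unit (plivf_pull f Y) = f ;; plivf_unit Y.
Proof.
by rewrite /plivf_unit /= !compA pair_prd_map comp_pair !compm1 comp1m compA
  bang_comp.
Qed.

Lemma plivf_unit_p (A : X) (Y : plivf C g A) :
  plivf_unit Y ;; tan_p T G = bang P A ;; gunit g.
Proof. by rewrite /plivf_unit -compA plivf_proj pair_pi1. Qed.

Lemma plivf_at_unit (A : X) (Y : plivf C g A) :
  plivf_map Y =
  pair P (pi1 P G A ;; tan_z T G) (pi2 P G A ;; plivf_unit Y) ;;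
    tan_mul C (gmul g).
Proof.
(* [h] is [(x, a) |-> ((x, e), a)]: left invariance read at [(x, e)] gives
   [Y(x e, a) = z(x) Y(e, a)]. *)
pose h := pair P (pair P (pi1 P G A) (bang P _ ;; gunit g)) (pi2 P G A).
have := congr1 (fun f => h ;; f) (plivf_inv Y).
rewrite /= !compA /h pair_prd_map pair_mul1r compm1.
rewrite -{1}[pi1 P G A]comp1m -{1}[pi2 P G A]comp1m -pairE comp1m => {1}->.
rewrite /prd_assoc comp_pair !compA !comp_pair !compA !(pair_pi1, pair_pi2).
by rewrite bang_comp compm1.
Qed.

Lemma plivf_unit_inj (A : X) (Y Z : plivf C g A) :
  plivf_unit Y = plivf_unit Z -> Y = Z.
Proof.
by move=> e; apply: plivf_ext; rewrite !plivf_at_unit e.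
Qed.

Lemma plivf_unit_surj (A : X) (a : A ~> T G) :
  a ;; tan_p T G = bang P A ;; gunit g ->
  exists Y : plivf C g A, plivf_unit Y = a.
Proof.
move=> ap.
pose Y := prd_map P (tan_z T G) a ;; tan_mul C (gmul g).
have Yp : Y ;; tan_p T G = pi1 P G A.
  rewrite /Y /prd_map tan_mul_p -!compA ap (compA (pi2 P G A)) bang_comp.
  by rewrite (bundle_zero_proj (tan_additive (tan_axioms T) G)) compm1
    pair_mul1r.
have Yi : prd_map P (gmul g) (idm A) ;; Y =
    prd_assoc P G G A ;; prd_map P (tan_z T G) Y ;; tan_mul C (gmul g).
  (* Since [z] is multiplicative, this is associativity in [T G]:
     [(z(x) z(y)) a = z(x) (z(y) a)]. *)
  rewrite /Y compA prd_mapM comp1m /prd_assoc pair_prd_map compA.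
  rewrite pair_prd_map -(pair_mulA (tan_group C g)) /= tan_mul_z.
  by rewrite -pairE /prd_map !compA.
exists (Plivf Yp Yi); rewrite /plivf_unit /= /Y compA pair_prd_map comp1m.
(* [z(e)] is the unit of [T G], so [z(e) a = a]. *)
by rewrite -compA gunit_z; apply: (pair_mul1l (tan_group C g)).
Qed.

Definition universal (V : X) (U : plivf C g V) : Prop :=
  forall (A : X) (Y : plivf C g A), exists! w : A ~> V, plivf_pull w U = Y.

(** Maps to [T G] over the unit correspond to PLIVFs by evaluation at the unit, and PLIVFs to maps
    into [V] by universality. *)
Lemma universal_pullback (V : X) (U : plivf C g V) : universal U ->
  is_pullback (plivf_unit U) (bang P V) (tan_p T G) (gunit g).
Proof.
move=> univU; split=> [|W a b ab]; first exact: plivf_unit_p.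
rewrite (bangE b) in ab *.
have [Y Ya] := plivf_unit_surj ab.
have [w [wY w_uniq]] := univU W Y.
exists w; split=> [|v [va _]].
  by split; [rewrite -plivf_unit_pull wY | exact: bang_comp].
by apply: w_uniq; apply: plivf_unit_inj; rewrite plivf_unit_pull va.
Qed.

End PlivfAtUnit.

(** The unit of [T G] is the image of that of [G], so evaluation at the unit commutes with [T]; only
    the flip in [tau] remains. *)
Lemma plivf_unit_tau (G : X) (g : group_object P G) (A : X)
    (Y : plivf C g A) :
  plivf_unit (plivf_tau Y) = fmap T (plivf_unit Y) ;; tan_c T G.
Proof.
rewrite /plivf_unit /= bang_tan_unit -(fmap1 T) !compA pair_tan_prd.
by rewrite -fmapM.
Qed.

(** The unit of [T^n G] starts at [1], the bottom edge of the required square at [T^n 1]; [u] is the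
    comparison isomorphism. *)
Lemma gunit_iter (G : X) (g : group_object P G) (n : nat) :
  exists2 u : one P ~> iter_obj T n (one P), bang P _ ;; u = idm _ &
    gunit (iter_group C g n) = u ;; iter_map T n (gunit g).
Proof.
elim: n => [|n [u uK e]] /=.
  exists (idm _); last by rewrite comp1m.
  by rewrite compm1 -(bangE (idm _)).
exists (tan_one C ;; fmap T u); last by rewrite /tan_unit e fmapM compA.
by rewrite compA bang_tan -fmapM uK fmap1.
Qed.

(** Moves the innermost [T] to the outermost place, past the other [n] copies one flip at a time. *)
Fixpoint flip (n : nat) (M : X) : iter_obj T n (T M) ~> T (iter_obj T n M) :=
  if n is k.+1 then fmap T (flip k M) ;; tan_c T (iter_obj T k M)
  else idm (T M).

Fixpoint unflip (n : nat) (M : X) : T (iter_obj T n M) ~> iter_obj T n (T M) :=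
  if n is k.+1 then tan_c T (iter_obj T k M) ;; fmap T (unflip k M)
  else idm (T M).

Lemma flipK (n : nat) (M : X) : flip n M ;; unflip n M = idm _.
Proof.
elim: n => [|n IHn] /=; first exact: comp1m.
rewrite -compA (compA (tan_c _ _)) (tan_cc (tan_axioms T)) comp1m.
by rewrite -fmapM IHn fmap1.
Qed.

Lemma unflipK (n : nat) (M : X) : unflip n M ;; flip n M = idm _.
Proof.
elim: n => [|n IHn] /=; first exact: comp1m.
by rewrite -compA (compA (fmap T _)) -fmapM IHn fmap1 comp1m
  (tan_cc (tan_axioms T)).
Qed.

Lemma flip_p (n : nat) (M : X) :
  flip n M ;; tan_p T (iter_obj T n M) = iter_map T n (tan_p T M).
Proof.
elim: n => [|n IHn] /=; first exact: comp1m.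
by rewrite -compA tan_c_p -fmapM IHn.
Qed.

Section Representation.
Variables (G : X) (g : group_object P G) (R : tangent_representation C g).

Definition iter_universal (n : nat) :
    plivf C (iter_group C g n) (iter_obj T n (rep_obj R)) :=
  rep_phiV (t := R) (idm _).

(** Yoneda: by naturality, [rep_phi] sends the pullback of the universal PLIVF along [w] to [w]
    itself. *)
Lemma universal_iter (n : nat) : universal (iter_universal n).
Proof.
have pullE (A : X) (w : A ~> iter_obj T n (rep_obj R)) :
    rep_phi R (plivf_pull w (iter_universal n)) = w.
  by rewrite rep_phiN rep_phiVK compm1.
move=> A Y; exists (rep_phi R Y); split=> [|w <-] //.
by apply: (can_inj (@rep_phiK _ _ _ _ _ _ R n A)); rewrite pullE.
Qed.

(** Compatibility with [tau] gives both sides the same image under [rep_phi], namely the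
    identity. *)
Lemma iter_universalS (n : nat) :
  iter_universal n.+1 = plivf_tau (iter_universal n).
Proof.
apply: (can_inj (@rep_phiK _ _ _ _ _ _ R n.+1 _)).
by rewrite rep_phi_tau !rep_phiVK fmap1.
Qed.

Lemma plivf_unit_iter (n : nat) :
  plivf_unit (iter_universal n) = iter_map T n (iota_unit R) ;; flip n G.
Proof.
elim: n => [|n IHn]; first by rewrite /= compm1.
by rewrite iter_universalS plivf_unit_tau IHn fmapM -compA.
Qed.

Lemma iota_unit_tangent_pullback :
  is_tangent_pullback T (iota_unit R) (bang P (rep_obj R))
    (tan_p T G) (gunit g).
Proof.
move=> n; have [u uK eu] := gunit_iter g n.
have [_ pb] := universal_pullback (@universal_iter n).
(* [T^n 1] is terminal, so legs into it need no further check. *)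
have uniq1 W (b b' : W ~> iter_obj T n (one P)) : b = b'.
  by rewrite -[b]compm1 -[b']compm1 -uK !compA !bang_comp.
have iotaE : iter_map T n (iota_unit R) =
    plivf_unit (iter_universal n) ;; unflip n G.
  by rewrite plivf_unit_iter -compA flipK compm1.
split=> [|W a b ab].
  rewrite -flip_p iotaE -compA (compA (unflip _ _)) unflipK comp1m.
  by rewrite plivf_unit_p eu compA; congr (_ ;; _).
(* The flip turns a cone over [T^n p_G] into one over [p_(T^n G)], where the universal PLIVF of
   [T^n G] supplies the lift. *)
have [w [[wa _] w_uniq]] : exists! w : W ~> iter_obj T n (rep_obj R),
    w ;; plivf_unit (iter_universal n) = a ;; flip n G /\
    w ;; bang P _ = bang P W.
  by apply: pb; rewrite -compA flip_p ab eu compA; congr (_ ;; _).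
exists w; split=> [|v [va _]].
  by split=> //; rewrite iotaE compA wa -compA flipK compm1.
by apply: w_uniq; split; [rewrite plivf_unit_iter compA va | exact: bang_comp].
Qed.

End Representation.
End TangentSpace.

Theorem proposition4p8 (X : category) (P : finite_products X)
    (T : tangent_structure X) (C : cartesian_tangent P T)
    (G : X) (g : group_object P G) (negG : admits_negatives T G)
    (R : tangent_representation C g) :
  is_tangent_pullback T (iota_unit R) (bang P (rep_obj R))
    (tan_p T G) (gunit g) /\
  is_tangent_space g (iota_unit R) /\
  is_lie_group T g.
Proof.
have pbR := iota_unit_tangent_pullback R.
by split=> //; split=> //; exists (rep_obj R), (iota_unit R).
Qed.
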